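(* Suppose $\mathfrak g$ is an affine Lie algebra, and $\theta,\kappa\in\mathbb Z^{\ell+1}$ are hubs (of integral weights for $\mathfrak g$) of the same level. Let $\psi=\theta-\kappa=(\psi_0,\dots,\psi_\ell)$. Then $\psi\in\sum_{i=0}^\ell\mathbb Z\overline\alpha_i$, where $\overline\alpha_i$ is the hub of the simple root $\alpha_i$, if and only if the coordinates of $\psi$ satisfy the following congruences, according to the type of $\mathfrak g$: - $A^{(1)}_\ell$ ($\ell\ge1$): $\psi_1+2\psi_2+\dots+\ell\psi_\ell\equiv0\pmod{\ell+1}$. - $B^{(1)}_\ell$ ($\ell\ge3$): $\psi_\ell\equiv0\pmod2$. - $C^{(1)}_\ell$ ($\ell\ge2$): $\psi_0+\psi_2+\psi_4+\dots\equiv0\pmod2$ (sum over all even indices in $\{0,\dots,\ell\}$). - $D^{(1)}_\ell$ ($\ell\ge4$, $\ell$ even): $\psi_0+\psi_1\equiv0\pmod2$ and $\psi_1+\psi_3+\psi_5+\dots+\psi_{\ell-1}\equiv0\pmod2$. - $D^{(1)}_\ell$ ($\ell\ge5$, $\ell$ odd): $\psi_0-\psi_1+2\psi_2+2\psi_4+2\psi_6+\dots+2\psi_{\ell-1}\equiv0\pmod4$. - $D^{(2)}_{\ell+1}$ ($\ell\ge2$): $\psi_0\equiv0\pmod2$. - $A^{(2)}_{2\ell-1}$ ($\ell\ge3$): $\psi_1+\psi_3+\psi_5+\dots\equiv0\pmod2$ (sum over all odd indices in $\{0,\dots,\ell\}$). - $E^{(1)}_6$: $\psi_0+2\psi_6\equiv\psi_5+2\psi_4\pmod3$.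 - $E^{(1)}_7$: $\psi_0+\psi_2+\psi_7\equiv0\pmod2$. - $A^{(2)}_{2\ell}$ ($\ell\ge1$), $E^{(1)}_8$, $E^{(2)}_6$, $F^{(1)}_4$, $G^{(1)}_2$, $D^{(3)}_4$: no condition (i.e. $\psi\in\sum_i\mathbb Z\overline\alpha_i$ always holds).
   Context: $\mathfrak g$ is the affine Kac--Moody algebra over $\mathbb C$ with $(\ell+1)\times(\ell+1)$ affine Cartan matrix $A=[a_{ij}]_{0\le i,j\le\ell}$, with Cartan subalgebra $\mathfrak h$ (of dimension $\ell+2$), simple roots $\alpha_0,\dots,\alpha_\ell\in\mathfrak h^*$ and simple coroots $h_0,\dots,h_\ell\in\mathfrak h$, $\langle h_i,\alpha_j\rangle=a_{ij}$. An integral weight is $\eta\in\mathfrak h^*$ with $\langle h_i,\eta\rangle\in\mathbb Z$ for all $i$. The hub of $\eta$ is the tuple $\theta(\eta)=(\langle h_0,\eta\rangle,\dots,\langle h_\ell,\eta\rangle)$. In particular the hub $\overline\alpha_j$ of $\alpha_j$ is the $j$th column $(a_{0j},\dots,a_{\ell j})$ of $A$. The level of a hub $\theta$ is $\sum_i a_i^\vee\theta_i$ (the level $\langle c,\eta\rangle$, $c=\sum_i a_i^\vee h_i$, of any weight $\eta$ with hub $\theta$), where $(a_0^\vee,\dots,a_\ell^\vee)$ are the coprime positive integers with $\sum_i a_i^\vee a_{ij}=0$ for all $j$. Kac's numbering of nodes is used, i.e. the Cartan matrices are as follows ($a_{ii}=2$; each listed pair $\{i,j\}$ gives $a_{ij}=a_{ji}=-1$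 except for the stated exceptions; all other off-diagonal entries are $0$; ''chain'' means the pairs $\{i,i+1\}$, $0\le i\le \ell-1$): $A^{(1)}_1$: $a_{01}=a_{10}=-2$. $A^{(1)}_\ell$ ($\ell\ge2$): chain and $\{\ell,0\}$. $B^{(1)}_\ell$ ($\ell\ge3$): $\{0,2\}$, $\{i,i+1\}$ for $1\le i\le\ell-1$, except $a_{\ell,\ell-1}=-2$. $C^{(1)}_\ell$ ($\ell\ge2$): chain, except $a_{1,0}=-2$, $a_{\ell-1,\ell}=-2$. $D^{(1)}_\ell$ ($\ell\ge4$): $\{0,2\}$, $\{i,i+1\}$ for $1\le i\le\ell-2$, $\{\ell-2,\ell\}$. $D^{(2)}_{\ell+1}$ ($\ell\ge2$): chain, except $a_{0,1}=-2$, $a_{\ell,\ell-1}=-2$. $A^{(2)}_{2\ell-1}$ ($\ell\ge3$): $\{0,2\}$, $\{i,i+1\}$ for $1\le i\le\ell-1$, except $a_{\ell-1,\ell}=-2$. $A^{(2)}_2$: $a_{01}=-4$, $a_{10}=-1$. $A^{(2)}_{2\ell}$ ($\ell\ge2$): chain, except $a_{0,1}=-2$, $a_{\ell-1,\ell}=-2$. $E^{(1)}_6$ ($\ell=6$): $\{1,2\},\{2,3\},\{3,4\},\{4,5\},\{3,6\},\{6,0\}$. $E^{(1)}_7$ ($\ell=7$): $\{i,i+1\}$ for $0\le i\le5$, and $\{3,7\}$. $E^{(1)}_8$ ($\ell=8$): $\{i,i+1\}$ for $0\le i\le 6$, and $\{5,8\}$. $F^{(1)}_4$: chain ($\ell=4$),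 except $a_{32}=-2$. $E^{(2)}_6$: chain ($\ell=4$), except $a_{23}=-2$. $G^{(1)}_2$: chain ($\ell=2$), except $a_{21}=-3$. $D^{(3)}_4$: chain ($\ell=2$), except $a_{12}=-3$. *)

(* Defs.v *)
From mathcomp Require Import all_boot all_order all_algebra.
From mathcomp Require Import reals complex.

Set Implicit Arguments.
Unset Strict Implicit.
Unset Printing Implicit Defensive.

Import GRing.Theory.
Local Open Scope ring_scope.

(** The affine types, with the rank [l] as argument of the infinite families.
    [D2 l], [A2odd l], [A2even l] are D^(2)_{l+1}, A^(2)_{2l-1}, A^(2)_{2l};
    [E26] and [D34] are E^(2)_6 and D^(3)_4; all others are untwisted. *)
Inductive affine_type : Type :=
| A1 (l : nat) of (1 <= l)%N
| B1 (l : nat) of (3 <= l)%N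
| C1 (l : nat) of (2 <= l)%N
| D1 (l : nat) of (4 <= l)%N
| D2 (l : nat) of (2 <= l)%N
| A2odd (l : nat) of (3 <= l)%N
| A2even (l : nat) of (1 <= l)%N
| E16 | E17 | E18 | F14 | E26 | G12 | D34.

(** The Cartan matrix has size [(rank X).+1]. *)
Definition rank (X : affine_type) : nat :=
  match X with
  | A1 l _ | B1 l _ | C1 l _ | D1 l _ | D2 l _ | A2odd l _ | A2even l _ => l
  | E16 => 6
  | E17 => 7
  | E18 => 8
  | F14 | E26 => 4
  | G12 | D34 => 2
  end.

Definition chain (m n : nat) : seq (nat * nat) :=
  [seq (i, i.+1) | i <- index_iota m n].

(** Dynkin diagrams in Kac's numbering; each edge is listed in one of its two
    orders. *)
Definition edges (X : affine_type) : seq (nat * nat) :=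
  match X with
  | A1 l _ => (l, 0%N) :: chain 0 l
  | B1 l _ | A2odd l _ => (0%N, 2%N) :: chain 1 l
  | C1 l _ | D2 l _ | A2even l _ => chain 0 l
  | D1 l _ => [:: (0%N, 2%N), (l - 2, l)%N & chain 1 l.-1]
  | E16 => [:: (3, 6)%N, (6, 0)%N & chain 1 5]
  | E17 => (3, 7)%N :: chain 0 6
  | E18 => (5, 8)%N :: chain 0 7
  | F14 | E26 => chain 0 4
  | G12 | D34 => chain 0 2
  end.

(** [((i, j), m)] means [a_ij = - m]; the entries [a_ij] for the remaining
    ordered pairs of adjacent nodes are [- 1]. *)
Definition exceptions (X : affine_type) : seq ((nat * nat) * nat) :=
  match X with
  | A1 l _ => if l == 1%N then [:: ((0, 1), 2); ((1, 0), 2)]%N else [::]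
  | B1 l _ => [:: ((l, l.-1), 2)]%N
  | C1 l _ => [:: ((1, 0), 2); ((l.-1, l), 2)]%N
  | D2 l _ => [:: ((0, 1), 2); ((l, l.-1), 2)]%N
  | A2odd l _ => [:: ((l.-1, l), 2)]%N
  | A2even l _ =>
      if l == 1%N then [:: ((0, 1), 4)]%N
      else [:: ((0, 1), 2); ((l.-1, l), 2)]%N
  | F14 => [:: ((3, 2), 2)]%N
  | E26 => [:: ((2, 3), 2)]%N
  | G12 => [:: ((2, 1), 3)]%N
  | D34 => [:: ((1, 2), 3)]%N
  | D1 _ _ | E16 | E17 | E18 => [::]
  end.

Definition multiplicity (X : affine_type) (i j : nat) : nat :=
  foldr (fun e m => if e.1 == (i, j) then e.2 else m) 1%N (exceptions X).

Definition cartan (X : affine_type) : 'M[int]_((rank X).+1) :=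
  \matrix_(i, j)
    if i == j then 2
    else if ((i : nat, j : nat) \in edges X) || ((j : nat, i : nat) \in edges X)
    then - (multiplicity X i j)%:Z
    else 0.

(** A realization of the Cartan matrix of an affine Kac-Moody algebra over [K]
    (Kac): here the matrix has size [n] and corank 1, whence the dimension
    [n + 1] of the Cartan subalgebra. *)
Record affine_realization (K : fieldType) (n : nat) (A : 'M[int]_n) := {
  cartan_subalgebra : vectType K;
  simple_coroot : 'I_n -> cartan_subalgebra;
  simple_root : 'I_n -> 'Hom(cartan_subalgebra, K^o);
  dim_cartan_subalgebra : \dim {: cartan_subalgebra} = n.+1;
  simple_coroots_free : free [seq simple_coroot i | i <- enum 'I_n];
  simple_roots_free : free [seq simple_root j | j <- enum 'I_n];
  simple_root_coroot :
    forall i j, simple_root j (simple_coroot i) = (A i j)%:~R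
}.

Section Weights.
Variables (K : fieldType) (n : nat) (A : 'M[int]_n).
Variable H : affine_realization K A.

Definition weight := 'Hom(cartan_subalgebra H, K^o).

Definition integral_weight (eta : weight) : Prop :=
  forall i, exists m : int, eta (simple_coroot H i) = m%:~R.

Definition hub (eta : weight) : 'rV[K]_n := \row_i eta (simple_coroot H i).

Definition is_integral_hub (theta : 'rV[int]_n) : Prop :=
  exists2 eta : weight, integral_weight eta & hub eta = map_mx intr theta.

Definition in_simple_root_hub_span (psi : 'rV[int]_n) : Prop :=
  exists z : 'I_n -> int,
    map_mx intr psi = \sum_j hub (simple_root H j) *~ z j.

End Weights.

(** These conditions determine [a] when [A] is an affine Cartan matrix. *)
Definition is_dual_labels (n : nat) (A : 'M[int]_n) (a : 'I_n -> nat) : Prop :=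
  [/\ forall i, (0 < a i)%N,
      \big[gcdn/0%N]_i a i = 1%N
    & forall j, \sum_i (a i)%:Z * A i j = 0].

Definition level (n : nat) (a : 'I_n -> nat) (theta : 'rV[int]_n) : int :=
  \sum_i (a i)%:Z * theta 0 i.

Definition congruences (X : affine_type) (psi : 'rV[int]_((rank X).+1)) : Prop :=
  let p (i : nat) : int := psi 0 (inord i) in
  match X with
  | A1 l _ => (\sum_(1 <= i < l.+1) i%:Z * p i = 0 %[mod l.+1])%Z
  | B1 l _ => (p l = 0 %[mod 2])%Z
  | C1 l _ => (\sum_(0 <= i < l.+1 | ~~ odd i) p i = 0 %[mod 2])%Z
  | D1 l _ =>
      if odd l then
        (p 0%N - p 1%N + \sum_(2 <= i < l | ~~ odd i) 2 * p i = 0 %[mod 4])%Z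
      else
        (p 0%N + p 1%N = 0 %[mod 2])%Z /\
        (\sum_(1 <= i < l | odd i) p i = 0 %[mod 2])%Z
  | D2 l _ => (p 0%N = 0 %[mod 2])%Z
  | A2odd l _ => (\sum_(0 <= i < l.+1 | odd i) p i = 0 %[mod 2])%Z
  | E16 => (p 0%N + 2 * p 6%N = p 5%N + 2 * p 4%N %[mod 3])%Z
  | E17 => (p 0%N + p 2%N + p 7%N = 0 %[mod 2])%Z
  | A2even _ _ | E18 | F14 | E26 | G12 | D34 => True
  end.

(* Main.v *)
(** [psi] lies in the span iff [A z = psi] has an integer solution [z]. The dual
    labels are a linear relation with positive coefficients between the rows of
    [A], so for [psi] of level 0 any one row of this system may be dropped. Each
    remaining row of a chain is a second-order recursion [z_{i+1} = 2 z_i -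
    z_{i-1} - psi_i], so the system is solved by running from one end of the
    diagram to the other; an obstruction appears only where the last rows ask
    for a division (by 2, 3 or [l + 1]), and telescoping the rows identifies it
    with the stated congruence. *)
Require Import Defs.
From mathcomp Require Import all_boot all_order all_algebra.
From mathcomp Require Import reals complex.
From mathcomp Require Import zify ring.

Set Implicit Arguments.
Unset Strict Implicit.
Unset Printing Implicit Defensive.

Import Order.TTheory GRing.Theory Num.Theory.
Local Open Scope ring_scope.

(** * Reduction to an integer linear system with rows indexed by naturals *)

Definition entry (X : affine_type) (i j : nat) : int :=
  if i == j then 2
  else if ((i, j) \in edges X) || ((j, i) \in edges X)
  then - (multiplicity X i j)%:Z
  else 0.

Definition cartan_row (X : affine_type) (z : nat -> int) (i : nat) : int :=
  \sum_(0 <= j < (rank X).+1) entry X i j * z j.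

Lemma cartan_entry X i j : cartan X i j = entry X i j.
Proof. by rewrite mxE /entry -val_eqE. Qed.

Lemma mulmx_row X (z : nat -> int) i :
  \sum_j cartan X i j * z j = cartan_row X z i.
Proof.
by rewrite /cartan_row big_mkord; apply: eq_bigr => j _; rewrite cartan_entry.
Qed.

(** The realization enters only through the pairing of roots with coroots, and [K] has
    characteristic zero, so equality of hubs over [K] descends to the integers. *)
Lemma spanP (K : numFieldType) (X : affine_type)
  (H : affine_realization K (cartan X))
  (psi : 'rV[int]_((rank X).+1)) :
  in_simple_root_hub_span H psi <->
  exists z : nat -> int,
    forall i, (i <= rank X)%N -> cartan_row X z i = psi 0 (inord i).
Proof.
have hubE (z : 'I_(rank X).+1 -> int) i :
    (\sum_j hub (simple_root H j) *~ z j) 0 i =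
    (\sum_j cartan X i j * z j)%:~R.
  rewrite summxE rmorph_sum; apply: eq_bigr => j _.
  by rewrite -scaler_int mxE [hub _ _ _]mxE simple_root_coroot
    rmorphM mulrC.
split=> [[z Hz]|[z Hz]].
  exists (fun j => z (inord j)) => i le_iX.
  have := congr1 (fun v : 'rV_ _ => v 0 (inord i)) Hz.
  rewrite hubE mxE => /intr_inj ->.
  rewrite -{1}(inordK (n' := rank X) (m := i)) // -mulmx_row.
  by apply: eq_bigr => j _; rewrite inord_val.
exists (fun j => z j); apply/rowP => i.
rewrite hubE mulmx_row Hz ?mxE ?inord_val //.
by rewrite -ltnS.
Qed.

(** The labels are kept as an unspecified positive left null vector, so that no type needs them
    written out. *)
Definition null_level (X : affine_type) (p : nat -> int) : Prop :=
  exists a : nat -> int,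
    [/\ forall i, 0 < a i,
        forall j, (j <= rank X)%N ->
          \sum_(0 <= i < (rank X).+1) a i * entry X i j = 0
      & \sum_(0 <= i < (rank X).+1) a i * p i = 0].

Lemma null_levelP X a (psi : 'rV_(rank X).+1) :
  is_dual_labels (cartan X) a -> level a psi = 0 ->
  null_level X (fun i => psi 0 (inord i)).
Proof.
case=> a_gt0 _ aA lev; exists (fun i => (a (inord i))%:Z); split=> [i|j le_jX|].
- by rewrite ltz_nat.
- rewrite -[RHS](aA (inord j)) big_mkord; apply: eq_bigr => i _.
  by rewrite inord_val cartan_entry inordK.
- by rewrite -[RHS]lev big_mkord; apply: eq_bigr => i _; rewrite inord_val.
Qed.

Lemma null_level_scale X p c :
  null_level X p -> null_level X (fun i => c * p i).
Proof.
case=> a [a_gt0 aA ap]; exists a; split=> //.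
under eq_bigr do rewrite mulrCA.
by rewrite -mulr_sumr ap mulr0.
Qed.

(** The labels annihilate the columns, so the defects [cartan_row X z k - p k], weighted by [a k],
    sum to zero. When all but the one at [r] vanish, positivity of [a r] kills that one too. *)
Lemma null_level_row X p z r :
  null_level X p -> (r <= rank X)%N ->
  (forall i, (i <= rank X)%N -> i != r -> cartan_row X z i = p i) ->
  forall i, (i <= rank X)%N -> cartan_row X z i = p i.
Proof.
case=> a [a_gt0 aA ap] le_rX Hz i le_iX.
have [->|] := eqVneq i r; last exact: Hz.
apply/eqP; rewrite -subr_eq0.
have: \sum_(0 <= k < (rank X).+1) a k * (cartan_row X z k - p k) = 0.
  under eq_bigr do rewrite mulrBr.
  rewrite big_split /= sumrN ap subr0 /cartan_row.
  under eq_bigr do rewrite mulr_sumr.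
  rewrite exchange_big_nat /= big_nat big1 // => j /andP[_ lt_j].
  under eq_bigr do rewrite mulrA.
  by rewrite -mulr_suml aA // mul0r.
rewrite (bigD1_seq r) ?mem_index_iota ?iota_uniq //= big1_seq.
  by rewrite addr0 => /eqP; rewrite mulf_eq0 gt_eqF.
move=> k /andP[neq_kr]; rewrite mem_index_iota => /andP[_ lt_k].
by rewrite Hz // subrr mulr0.
Qed.

(** * Explicit rows of the infinite families *)

Lemma sparse_row X (z : nat -> int) (i : nat) (s : seq (nat * int)) :
  all (fun e => e.1 <= rank X)%N s ->
  (forall j, (j <= rank X)%N ->
    entry X i j = \sum_(e <- s) if j == e.1 then e.2 else 0) ->
  cartan_row X z i = \sum_(e <- s) e.2 * z e.1.
Proof.
move=> /allP le_s Hs; rewrite /cartan_row.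
under eq_big_nat => j /andP[_ lt_j] do rewrite Hs // mulr_suml.
rewrite exchange_big /= big_seq [RHS]big_seq; apply: eq_bigr => e /le_s le_e.
rewrite (bigD1_seq e.1) ?mem_index_iota ?iota_uniq //= eqxx big1 ?addr0 //.
by move=> j /negPf ->; rewrite mul0r.
Qed.

Lemma mem_chain m n i j :
  ((i, j) \in chain m n) = [&& (m <= i)%N, (i < n)%N & j == i.+1].
Proof.
apply/mapP/and3P => [[k + [-> ->]]|[le_mi lt_in /eqP->]].
  by rewrite mem_index_iota => /andP[]; split.
by exists i; rewrite // mem_index_iota le_mi.
Qed.

(* In these variables, the interior rows of the infinite families become those
   of a chain with simple edges. *)
Definition fold (X : affine_type) (z : nat -> int) (j : nat) : int :=
  match X with
  | A1 l _ => if j == l.+1 then z 0%N else z j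
  | B1 l _ => if j == 1%N then z 0%N + z 1%N else z j
  | C1 l _ => if (j == 0%N) || (j == l) then 2 * z j else z j
  | D1 l _ => if j == 1%N then z 0%N + z 1%N
              else if j == l.-1 then z l.-1 + z l else z j
  | A2odd l _ => if j == 1%N then z 0%N + z 1%N
                 else if j == l then 2 * z l else z j
  | A2even l _ => if j == l then 2 * z l else z j
  | _ => z j
  end.

(** Equation [i] is row [i.+1]; the shift avoids predecessors. *)
Definition chain_eq (f p : nat -> int) (i : nat) : Prop :=
  p i.+1 = 2 * f i.+1 - f i - f i.+2.

(* The three branches left by [sparse_row] are the expansion of the proposed row, the bounds on its
   indices, and the comparison with the matrix entries by cases. *)
Tactic Notation "sparse" uconstr(s) :=
  rewrite /chain_eq (sparse_row _ (s := s : seq (nat * int))) /=;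
  [ rewrite !big_cons big_nil /fold;
    repeat (case: eqP => ? /=; try subst; try lia);
    rewrite ?subrr ?addr0 /=; try ring
  | by rewrite /= ?andbT; repeat case: ifP; lia
  | let j := fresh "j" in move=> j /= ?; rewrite !big_cons big_nil /=;
    rewrite /entry /edges /multiplicity /exceptions /= ?inE ?mem_chain
      ?xpair_eqE /=;
    repeat case: ifP; rewrite /= ?xpair_eqE; repeat case: ifP; lia ].

Lemma chain_eq_A1 l (hl : (1 <= l)%N) z i : (i < l)%N ->
  chain_eq (fold (A1 hl) z) (cartan_row (A1 hl) z) i.
Proof.
move=> lt_il.
(* For [l = 1] the index 0 occurs twice, and the two entries -1 add up to the exceptional entry
   -2. *)
sparse [:: (i, -1); (i.+1, 2); (if i.+1 == l then 0%N else i.+2, -1)].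
Qed.

Lemma row_B1_1 l (hl : (3 <= l)%N) z :
  cartan_row (B1 hl) z 1 = 2 * z 1%N - z 2%N.
Proof. sparse [:: (1%N, 2); (2%N, -1)]. Qed.

Lemma chain_eq_B1 l (hl : (3 <= l)%N) z i : (0 < i)%N -> (i.+1 < l)%N ->
  chain_eq (fold (B1 hl) z) (cartan_row (B1 hl) z) i.
Proof.
move=> i_gt0 lt_il.
(* Node 0 hangs on node 2, hence shows up in row 2 only, that is for [i = 1]. *)
sparse [:: (i, -1); (i.+1, 2); (i.+2, -1); (0%N, if i == 1%N then -1 else 0)].
Qed.

Lemma row_B1_last l (hl : (3 <= l)%N) z :
  cartan_row (B1 hl) z l = 2 * z l - 2 * z l.-1.
Proof. sparse [:: (l.-1, -2); (l, 2)]. Qed.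

Lemma row_C1_0 l (hl : (2 <= l)%N) z :
  cartan_row (C1 hl) z 0 = fold (C1 hl) z 0 - fold (C1 hl) z 1.
Proof. sparse [:: (0%N, 2); (1%N, -1)]. Qed.

Lemma chain_eq_C1 l (hl : (2 <= l)%N) z i : (i.+1 < l)%N ->
  chain_eq (fold (C1 hl) z) (cartan_row (C1 hl) z) i.
Proof.
move=> lt_il.
sparse [:: (i, if i == 0%N then -2 else -1); (i.+1, 2);
           (i.+2, if i.+2 == l then -2 else -1)].
Qed.

Lemma row_C1_last l (hl : (2 <= l)%N) z :
  cartan_row (C1 hl) z l = fold (C1 hl) z l - fold (C1 hl) z l.-1.
Proof. sparse [:: (l.-1, -1); (l, 2)]. Qed.

Lemma row_D1_0 l (hl : (4 <= l)%N) z :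
  cartan_row (D1 hl) z 0 = 2 * z 0%N - z 2%N.
Proof. sparse [:: (0%N, 2); (2%N, -1)]. Qed.

Lemma row_D1_1 l (hl : (4 <= l)%N) z :
  cartan_row (D1 hl) z 1 = 2 * z 1%N - z 2%N.
Proof. sparse [:: (1%N, 2); (2%N, -1)]. Qed.

Lemma chain_eq_D1 l (hl : (4 <= l)%N) z i : (0 < i)%N -> (i.+2 < l)%N ->
  chain_eq (fold (D1 hl) z) (cartan_row (D1 hl) z) i.
Proof.
move=> i_gt0 lt_il.
sparse [:: (i, -1); (i.+1, 2); (i.+2, -1); (0%N, if i == 1%N then -1 else 0);
           (l, if i.+3 == l then -1 else 0)].
Qed.

Lemma row_D1_penult l (hl : (4 <= l)%N) z :
  cartan_row (D1 hl) z l.-1 = 2 * z l.-1 - z l.-2.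
Proof. sparse [:: (l.-2, -1); (l.-1, 2)]. Qed.

Lemma row_D2_0 l (hl : (2 <= l)%N) z :
  cartan_row (D2 hl) z 0 = 2 * z 0%N - 2 * z 1%N.
Proof. sparse [:: (0%N, 2); (1%N, -2)]. Qed.

Lemma chain_eq_D2 l (hl : (2 <= l)%N) z i : (i.+1 < l)%N ->
  chain_eq (fold (D2 hl) z) (cartan_row (D2 hl) z) i.
Proof. by move=> lt_il; sparse [:: (i, -1); (i.+1, 2); (i.+2, -1)]. Qed.

Lemma row_A2odd_1 l (hl : (3 <= l)%N) z :
  cartan_row (A2odd hl) z 1 = 2 * z 1%N - z 2%N.
Proof. sparse [:: (1%N, 2); (2%N, -1)]. Qed.

Lemma chain_eq_A2odd l (hl : (3 <= l)%N) z i : (0 < i)%N -> (i.+1 < l)%N ->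
  chain_eq (fold (A2odd hl) z) (cartan_row (A2odd hl) z) i.
Proof.
move=> i_gt0 lt_il.
sparse [:: (i, -1); (i.+1, 2); (i.+2, if i.+2 == l then -2 else -1);
           (0%N, if i == 1%N then -1 else 0)].
Qed.

Lemma row_A2odd_last l (hl : (3 <= l)%N) z :
  cartan_row (A2odd hl) z l = 2 * z l - z l.-1.
Proof. sparse [:: (l.-1, -1); (l, 2)]. Qed.

Lemma chain_eq_A2even l (hl : (1 <= l)%N) z i : (i.+1 < l)%N ->
  chain_eq (fold (A2even hl) z) (cartan_row (A2even hl) z) i.
Proof.
move=> lt_il.
sparse [:: (i, -1); (i.+1, 2); (i.+2, if i.+2 == l then -2 else -1)].
Qed.

Lemma row_A2even_last l (hl : (1 <= l)%N) z :
  cartan_row (A2even hl) z l = 2 * z l - z l.-1.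
Proof. sparse [:: (l.-1, -1); (l, 2)]. Qed.

(** * The exceptional types, solved by explicit vectors *)

Ltac rows :=
  rewrite /cartan_row unlock /entry /multiplicity /= ?mul0r ?addr0 ?add0r.

Lemma E16P p : null_level E16 p ->
  (exists z, forall i, (i <= 6)%N -> cartan_row E16 z i = p i) <->
  (p 0%N + 2 * p 6%N = p 5%N + 2 * p 4%N %[mod 3])%Z.
Proof.
move=> lev; split=> [[z Hz]|Hp].
  by rewrite -!Hz //; rows; lia.
(* [k] is the value at node 5. With value 0 at node 0, the branch 0, 6 gives [z3 = - 2 * p 0 - p 6],
   the branch 5, 4 gives [z3 = 3 * k - 2 * p 5 - p 4]. *)
have [k Hk] : exists k, 3 * k = 2 * p 5%N + p 4%N - 2 * p 0%N - p 6%N.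
  by exists ((2 * p 5%N + p 4%N - 2 * p 0%N - p 6%N) %/ 3)%Z; lia.
pose z4 := 2 * k - p 5%N; pose z3 := 2 * z4 - k - p 4%N.
pose z2 := 2 * z3 - z4 + p 0%N - p 3%N.
exists (nth 0 [:: 0; 2 * z2 - z3 - p 2%N; z2; z3; z4; k; - p 0%N]).
apply: (null_level_row lev (r := 1%N)) => // i.
by case: i => [|[|[|[|[|[|[|//]]]]]]] // _ _; rows; rewrite /z2 /z3 /z4; lia.
Qed.

Lemma E17P p : null_level E17 p ->
  (exists z, forall i, (i <= 7)%N -> cartan_row E17 z i = p i) <->
  (p 0%N + p 2%N + p 7%N = 0 %[mod 2])%Z.
Proof.
move=> lev; split=> [[z Hz]|Hp].
  by rewrite -!Hz //; rows; lia.
pose z2 := - 2 * p 0%N - p 1%N; pose z3 := 2 * z2 + p 0%N - p 2%N.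
(* Row 7 is the only one that asks for a division. *)
have [z7 Hz7] : exists k, 2 * k = z3 + p 7%N.
  by exists ((z3 + p 7%N) %/ 2)%Z; rewrite /z3 /z2; lia.
pose z4 := 2 * z3 - z2 - z7 - p 3%N; pose z5 := 2 * z4 - z3 - p 4%N.
exists (nth 0 [:: 0; - p 0%N; z2; z3; z4; z5; 2 * z5 - z4 - p 5%N; z7]).
apply: (null_level_row lev (r := 6)) => // i.
case: i => [|[|[|[|[|[|[|[|//]]]]]]]] // _ _; rows;
  by move: Hz7; rewrite /z5 /z4 /z3 /z2; lia.
Qed.

Lemma E18P p : null_level E18 p ->
  exists z, forall i, (i <= 8)%N -> cartan_row E18 z i = p i.
Proof.
move=> lev.
(* Rows 7 and 6 give [z5 = 3 * z7 - 2 * p 7 - p 6], and row 8 asks for half of [z5 + p 8]; this [z7]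
   makes that number even. *)
pose z7 := p 6%N + p 8%N; pose z6 := 2 * z7 - p 7%N.
pose z5 := 2 * z6 - z7 - p 6%N; pose z8 := p 6%N + 2 * p 8%N - p 7%N.
pose z4 := 2 * z5 - z6 - z8 - p 5%N; pose z3 := 2 * z4 - z5 - p 4%N.
pose z2 := 2 * z3 - z4 - p 3%N; pose z1 := 2 * z2 - z3 - p 2%N.
exists (nth 0 [:: 2 * z1 - z2 - p 1%N; z1; z2; z3; z4; z5; z6; z7; z8]).
apply: (null_level_row lev (r := 0%N)) => // i.
case: i => [|[|[|[|[|[|[|[|[|//]]]]]]]]] // _ _; rows;
  by rewrite /z1 /z2 /z3 /z4 /z5 /z6 /z7 /z8; lia.
Qed.

Lemma F14P p : null_level F14 p ->
  exists z, forall i, (i <= 4)%N -> cartan_row F14 z i = p i.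
Proof.
move=> lev.
(* Taking equal values at nodes 2 and 3 cancels the entries 2 and -2 of row 3, which then gives
   [- p 3] at node 4 without a division. *)
pose z3 := - 2 * p 3%N - p 4%N; pose z1 := z3 - p 2%N.
exists (nth 0 [:: 2 * z1 - z3 - p 1%N; z1; z3; z3; - p 3%N]).
apply: (null_level_row lev (r := 0%N)) => // i.
by case: i => [|[|[|[|[|//]]]]] // _ _; rows; rewrite /z1 /z3; lia.
Qed.

Lemma E26P p : null_level E26 p ->
  exists z, forall i, (i <= 4)%N -> cartan_row E26 z i = p i.
Proof.
move=> lev.
pose z2 := - 2 * p 4%N - p 3%N; pose z1 := 2 * z2 + 2 * p 4%N - p 2%N.
exists (nth 0 [:: 2 * z1 - z2 - p 1%N; z1; z2; - p 4%N; 0]).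
apply: (null_level_row lev (r := 0%N)) => // i.
by case: i => [|[|[|[|[|//]]]]] // _ _; rows; rewrite /z1 /z2; lia.
Qed.

Lemma G12P p : null_level G12 p ->
  exists z, forall i, (i <= 2)%N -> cartan_row G12 z i = p i.
Proof.
(* Row 2 reads [2 * z 2 - 3 * z 1 = p 2], and [2 * 2 - 3 * 1 = 1]. *)
move=> lev; exists (nth 0 [:: - p 1%N; p 2%N; 2 * p 2%N]).
apply: (null_level_row lev (r := 0%N)) => // i.
by case: i => [|[|[|//]]] // _ _; rows; lia.
Qed.

Lemma D34P p : null_level D34 p ->
  exists z, forall i, (i <= 2)%N -> cartan_row D34 z i = p i.
Proof.
move=> lev; exists (nth 0 [:: - 2 * p 2%N - p 1%N; - p 2%N; 0]).
apply: (null_level_row lev (r := 0%N)) => // i.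
by case: i => [|[|[|//]]] // _ _; rows; lia.
Qed.

(** * Solutions of the chain recursion and their telescoped sums *)

Lemma chain_up x y p :
  exists f, [/\ f 0%N = x, f 1%N = y & forall i, chain_eq f p i].
Proof.
pose step n (c : int * int) := (c.2, 2 * c.2 - c.1 - p n.+1).
exists (fun n => (nat_rect _ (x, y) step n).1).
by split=> // i; rewrite /chain_eq /=; lia.
Qed.

(** The recursion is invariant under reversal of the chain, so [chain_up] can be read through
    [i -> l.+1 - i]. *)
Lemma chain_down l x y p :
  exists f, [/\ f l = x, f l.+1 = y & forall i, (i < l)%N -> chain_eq f p i].
Proof.
have [g [g0 g1 Hg]] := chain_up y x (fun j => p (l.+1 - j)%N).
exists (fun i => g (l.+1 - i)%N); split; rewrite ?subSnn ?subnn // => i lt_il.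
have := Hg (l - i.+1)%N; rewrite /chain_eq.
have -> : ((l - i.+1).+2 = l.+1 - i)%N by lia.
have -> : ((l - i.+1).+1 = l.+1 - i.+1)%N by lia.
have -> : ((l - i.+1) = l.+1 - i.+2)%N by lia.
have -> : (l.+1 - (l.+1 - i.+1) = i.+1)%N by lia.
by lia.
Qed.

(* Modulo 2 an interior row reads [p i = f i.-1 + f i.+1], so that the sum over
   the indices of one parity telescopes. *)
Lemma sum_parity (P : pred nat) f p m n :
  (forall i, P i.+1 = ~~ P i) -> (0 < m <= n)%N ->
  (forall i, (m <= i.+1 < n)%N -> chain_eq f p i) ->
  exists k, \sum_(m <= i < n | P i) p i =
    f (if P n then n.-1 else n) + f (if P m then m.-1 else m) + 2 * k.
Proof.
move=> altP /andP[m_gt0]; elim: n => [|n IHn].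
  by case: m m_gt0.
rewrite leq_eqVlt => /predU1P[-> _|le_mn Hf].
  by rewrite big_geq //=; set x := f _; exists (- x); lia.
have [i lt_i|k Hk] := IHn le_mn.
  by apply: Hf; lia.
rewrite big_mkcond big_nat_recr //= -big_mkcond Hk altP.
case: n => [|n] in le_mn Hf {IHn Hk} *; first by lia.
case: ifP => _ /=; last by exists k; lia.
by exists (k + f n.+1 - f n.+2); rewrite (Hf n); lia.
Qed.

(** Abel summation: the second difference of the weights [i] is zero, so only boundary terms
    survive. *)
Lemma weighted_sum f p n :
  (forall i, (i < n)%N -> chain_eq f p i) ->
  \sum_(1 <= i < n.+1) i%:Z * p i = n.+1%:Z * f n - n%:Z * f n.+1 - f 0%N.
Proof.
elim: n => [|n IHn] Hf; first by rewrite big_geq //; lia.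
rewrite big_nat_recr // IHn => [|i lt_in] /=; last by apply: Hf; lia.
by rewrite (Hf n) //; lia.
Qed.

(** * Solvability criteria for the infinite families *)

Lemma A1P l (hl : (1 <= l)%N) p : null_level (A1 hl) p ->
  (exists z, forall i, (i <= l)%N -> cartan_row (A1 hl) z i = p i) <->
  (\sum_(1 <= i < l.+1) i%:Z * p i = 0 %[mod l.+1])%Z.
Proof.
move=> lev; split=> [[z Hz]|/eqP].
  rewrite (weighted_sum (f := fold (A1 hl) z)) => [|i lt_il]; last first.
    by rewrite /chain_eq -Hz //; apply: chain_eq_A1.
  rewrite /= eqxx ltn_eqF //; apply/eqP; rewrite eqz_mod_dvd subr0.
  by apply/dvdzP; exists (z l - z 0%N); lia.
rewrite eqz_mod_dvd subr0 => /dvdzP[k Hk].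
have [f [f0 _ Hf]] := chain_up 0 0 p.
rewrite (weighted_sum (f := f)) // f0 in Hk.
(* The recursion is unaffected by adding a linear function. [Hk] amounts to
   [f l.+1 = l.+1 * (f l.+1 - f l + k)], so this slope gives [g l.+1 = 0 = g 0] and closes the
   cycle. *)
pose t := - (f l.+1 - f l + k); pose g i := f i + t * i%:Z.
have foldg j : fold (A1 hl) g j = g j.
  by rewrite /=; case: eqP => // ->; rewrite /g f0 /t; lia.
exists g; apply: (null_level_row lev (r := 0%N)) => // -[|i] //= lt_il _.
by rewrite (chain_eq_A1 hl) // !foldg Hf /g; lia.
Qed.

Lemma B1P l (hl : (3 <= l)%N) p : null_level (B1 hl) p ->
  (exists z, forall i, (i <= l)%N -> cartan_row (B1 hl) z i = p i) <->
  (p l = 0 %[mod 2])%Z.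
Proof.
move=> lev; split=> [[z Hz]|Hp].
  by rewrite -Hz // row_B1_last; lia.
case: l => [//|l] in hl p lev Hp *.
have [h Hh] : exists h, 2 * h = p l.+1 by exists (p l.+1 %/ 2)%Z; lia.
have [f [fl fl1 Hf]] := chain_down l (- h) 0 p.
(* A constant shift changes neither the interior rows nor the last one; it is used to make the
   number halved in row 1 even. *)
pose t := ((f 2%N + p 1%N) %% 2)%Z.
have [z1 Hz1] : exists k, 2 * k = f 2%N + t + p 1%N.
  by exists ((f 2%N + t + p 1%N) %/ 2)%Z; rewrite /t; lia.
pose z i := if i == 0%N then f 1%N + t - z1 else if i == 1%N then z1
            else f i + t.
have zE i : (1 < i)%N -> z i = f i + t by case: i => [|[]].
have foldz j : (0 < j)%N -> fold (B1 hl) z j = f j + t.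
  by rewrite /= /z; case: j => [|[|j]] //= _; lia.
exists z; apply: (null_level_row lev (r := 0%N)) => // -[|[|i]] //= lt_il _.
  by rewrite row_B1_1 /z /=; lia.
have [->|ne_il] := eqVneq i.+1 l.
  by rewrite row_B1_last /= !zE; lia.
by rewrite (chain_eq_B1 hl); [rewrite !foldz // (Hf i.+1)| |]; lia.
Qed.

(** The end rows cancel the inner boundary terms of [sum_parity] modulo 2. Here [f] is arbitrary, so
    that it need not be the folding of an integral vector. *)
Lemma C1_sum_parity l f p : (2 <= l)%N ->
  p 0%N = f 0%N - f 1%N -> (forall i, (i.+1 < l)%N -> chain_eq f p i) ->
  p l = f l - f l.-1 ->
  exists k, \sum_(0 <= i < l.+1 | ~~ odd i) p i = f 0%N + f l + 2 * k.
Proof.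
move=> hl p0 Hf pl.
rewrite big_mkcond big_ltn // big_nat_recr 1?ltnW //= -big_mkcond.
have [|i|k ->] := @sum_parity (fun i => ~~ odd i) f p 1 l (fun=> erefl).
- by lia.
- by move=> lt_il; apply: Hf; lia.
by exists k; rewrite p0 pl; case: ifP => _ /=; lia.
Qed.

Lemma C1P l (hl : (2 <= l)%N) p : null_level (C1 hl) p ->
  (exists z, forall i, (i <= l)%N -> cartan_row (C1 hl) z i = p i) <->
  (\sum_(0 <= i < l.+1 | ~~ odd i) p i = 0 %[mod 2])%Z.
Proof.
move=> lev; split=> [[z Hz]|].
  have [//|||//|k ->] := @C1_sum_parity l (fold (C1 hl) z) p.
  - by rewrite -Hz // row_C1_0.
  - by move=> i lt_il; rewrite /chain_eq -Hz; [apply: chain_eq_C1 | lia].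
  - by rewrite -Hz // row_C1_last.
  by rewrite /= eqxx orbT; lia.
have [f [f0 f1 Hf]] := chain_up 0 (- p 0%N) p.
(* [f] need not be the folding of an integral vector, but [2 f] is, so that the
   level gives the last row for [2 p]. *)
have Hfl : p l = f l - f l.-1.
  pose w i := if (i == 0%N) || (i == l) then f i else 2 * f i.
  have foldw i : fold (C1 hl) w i = 2 * f i.
    by rewrite /= /w; case: orP.
  have := null_level_row (z := w) (null_level_scale 2 lev) (leqnn l).
  move=> /(_ _ l); rewrite row_C1_last !foldw => Hl.
  suff: 2 * f l - 2 * f l.-1 = 2 * p l by lia.
  apply: Hl => // -[|i] /= le_il ne_il.
    by rewrite row_C1_0 !foldw f0 f1; lia.
  by rewrite (chain_eq_C1 hl); [rewrite !foldw (Hf i)|]; lia.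
have [//|||//|k ->] := @C1_sum_parity l f p; rewrite ?f0 ?f1 //; first by lia.
(* As [f 0 = 0], the congruence says that [f l] is even, which is what unfolding at node [l]
   requires. *)
move=> Hp; have [h Hh] : exists h, 2 * h = f l by exists (f l %/ 2)%Z; lia.
pose z i := if i == l then h else f i.
have foldz i : fold (C1 hl) z i = f i.
  rewrite /= /z; have [->|_] := eqVneq i l; first by rewrite orbT.
  by rewrite orbF; case: eqP => // ->; rewrite f0.
exists z => -[|i] le_il.
  by rewrite row_C1_0 !foldz f0 f1; lia.
have [->|ne_il] := eqVneq i.+1 l; first by rewrite row_C1_last !foldz.
by rewrite (chain_eq_C1 hl) ?foldz ?(Hf i) //; lia.
Qed.

Lemma D1P l (hl : (4 <= l)%N) p : null_level (D1 hl) p ->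
  (exists z, forall i, (i <= l)%N -> cartan_row (D1 hl) z i = p i) <->
  if odd l then
    (p 0%N - p 1%N + \sum_(2 <= i < l | ~~ odd i) 2 * p i = 0 %[mod 4])%Z
  else
    (p 0%N + p 1%N = 0 %[mod 2])%Z /\
    (\sum_(1 <= i < l | odd i) p i = 0 %[mod 2])%Z.
Proof.
move=> lev.
(* Node [l.-1] is a leg of the fork, outside the recursion, so [p l.-1] stays as a separate term in
   both sums. *)
have even_sum f : ~~ odd l ->
    (forall i, (0 < i)%N -> (i.+2 < l)%N -> chain_eq f p i) ->
    exists k, \sum_(1 <= i < l | odd i) p i =
      p 1%N + f 2%N + f l.-2 + p l.-1 + 2 * k.
  case: l hl lev => [|l] //= hl _ l_odd Hf; rewrite negbK in l_odd.
  have [l_gt0 l_gt1] : (1 < l.+1)%N /\ (1 < l)%N by lia.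
  rewrite big_mkcond big_ltn // big_nat_recr //= -big_mkcond l_odd.
  have [|i|k ->] := @sum_parity odd f p 2 l (fun=> erefl); first by lia.
    by move=> lt_il; apply: Hf; lia.
  by rewrite l_odd /=; exists k; lia.
have odd_sum f : odd l ->
    (forall i, (0 < i)%N -> (i.+2 < l)%N -> chain_eq f p i) ->
    exists k, \sum_(2 <= i < l | ~~ odd i) p i =
      f 1%N + f l.-2 + p l.-1 + 2 * k.
  case: l hl lev {even_sum} => [|l] //= hl _ l_even Hf.
  have l_gt1 : (1 < l)%N by lia.
  rewrite big_mkcond big_nat_recr //= -big_mkcond l_even.
  have [|i|k ->] := @sum_parity (fun i => ~~ odd i) f p 2 l (fun=> erefl).
  - by lia.
  - by move=> lt_il; apply: Hf; lia.
  by rewrite l_even /=; exists k; lia.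
split=> [[z Hz]|Hp].
  have Hf i : (0 < i)%N -> (i.+2 < l)%N -> chain_eq (fold (D1 hl) z) p i.
    by move=> i_gt0 lt_il; rewrite /chain_eq -Hz; [apply: chain_eq_D1 | lia].
  have := Hz l.-1 (leq_pred l); rewrite row_D1_penult => pl.
  have := Hz 0%N isT; rewrite row_D1_0 => p0.
  have := Hz 1%N (ltnW (ltnW (ltnW hl))); rewrite row_D1_1 => p1.
  have foldz i : (1 < i)%N -> (i < l.-1)%N -> fold (D1 hl) z i = z i.
    by move=> i_gt1 lt_il /=; rewrite !ifN //; lia.
  have fold1 : fold (D1 hl) z 1%N = z 0%N + z 1%N by [].
  case: ifP => [l_odd|/negbT l_even].
    have [k Hk] := odd_sum _ l_odd Hf.
    by rewrite -mulr_sumr Hk fold1 foldz; lia.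
  have [k ->] := even_sum _ l_even Hf.
  by rewrite !foldz; lia.
have [h Hh] : exists h, 2 * h = p 0%N + p 1%N.
  exists ((p 0%N + p 1%N) %/ 2)%Z; case: ifP Hp => _; last by lia.
  by rewrite -mulr_sumr; lia.
(* The initial values are chosen so that [f 2 = p 1]: then [z_1 = p 1] and
   [z_0 = h] solve rows 0 and 1. *)
have [f [f0 f1 Hf]] := chain_up (2 * h) (p 1%N + h) p.
have f2 : f 2%N = p 1%N by have := Hf 0%N; rewrite /chain_eq f0 f1; lia.
(* [k] will be the value at node [l.-1]. For odd [l], [p 0 - p 1 + 2 * f 1 = 4 * h], so the
   congruence modulo 4 leaves the parity of [f l.-2 + p l.-1]; for even [l], [p 1 + f 2 = 2 * p 1]
   drops out. *)
have [k Hk] : exists k, 2 * k = f l.-2 + p l.-1.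
  exists ((f l.-2 + p l.-1) %/ 2)%Z; case: ifP Hp => [l_odd|/negbT l_even].
    have [//|k Hk] := odd_sum f l_odd.
    by rewrite -mulr_sumr Hk f1 /=; lia.
  have [//|k ->] := even_sum f l_even.
  by rewrite f2; lia.
pose z i := if i == 0%N then h else if i == 1%N then p 1%N
            else if i == l.-1 then k else if i == l then f l.-1 - k else f i.
have zl : z l = f l.-1 - k by rewrite /z eqxx !ifN //; lia.
have zl1 : z l.-1 = k by rewrite /z eqxx !ifN //; lia.
have zE i : (1 < i)%N -> (i < l.-1)%N -> z i = f i.
  by move=> i_gt1 lt_il; rewrite /z !ifN //; lia.
have foldz i : (0 < i)%N -> (i < l)%N -> fold (D1 hl) z i = f i.
  move=> i_gt0 lt_il; rewrite /= zl zl1.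
  case: eqP => [->|ne_i1]; first by rewrite f1 /z /=; lia.
  by case: eqP => [->|ne_il]; [lia | rewrite zE //; lia].
exists z; apply: (null_level_row lev (r := l)) => // -[|[|i]] /= le_il ne_il.
- by rewrite row_D1_0 (zE 2%N) ?f2 /z /=; lia.
- by rewrite row_D1_1 (zE 2%N) ?f2 /z /=; lia.
have [Ei|ne_i] := eqVneq i.+2 l.-1.
  by rewrite Ei row_D1_penult zl1 zE; lia.
by rewrite (chain_eq_D1 hl) ?foldz ?(Hf i.+1) //; lia.
Qed.

Lemma D2P l (hl : (2 <= l)%N) p : null_level (D2 hl) p ->
  (exists z, forall i, (i <= l)%N -> cartan_row (D2 hl) z i = p i) <->
  (p 0%N = 0 %[mod 2])%Z.
Proof.
move=> lev; split=> [[z Hz]|Hp].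
  by rewrite -Hz // row_D2_0; lia.
have [h Hh] : exists h, 2 * h = p 0%N by exists (p 0%N %/ 2)%Z; lia.
have [f [f0 f1 Hf]] := chain_up 0 (- h) p.
exists f; apply: (null_level_row lev (r := l)) => // -[|i] /= le_il ne_il.
  by rewrite row_D2_0 f0 f1; lia.
by rewrite (chain_eq_D2 hl) /= ?(Hf i) // ltn_neqAle ne_il.
Qed.

Lemma A2oddP l (hl : (3 <= l)%N) p : null_level (A2odd hl) p ->
  (exists z, forall i, (i <= l)%N -> cartan_row (A2odd hl) z i = p i) <->
  (\sum_(0 <= i < l.+1 | odd i) p i = 0 %[mod 2])%Z.
Proof.
move=> lev.
have odd_sum f : (forall i, (0 < i)%N -> (i.+1 < l)%N -> chain_eq f p i) ->
    p l = f l - f l.-1 ->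
    exists k, \sum_(0 <= i < l.+1 | odd i) p i = p 1%N + f 2%N + f l + 2 * k.
  move=> Hf pl; have [l_gt0 l_gt1] : (0 < l)%N /\ (1 < l)%N by lia.
  rewrite big_mkcond big_ltn // big_ltn // big_nat_recr //= -big_mkcond.
  have [|i|k ->] := @sum_parity odd f p 2 l (fun=> erefl); first by lia.
    by move=> lt_il; apply: Hf; lia.
  by exists k; rewrite pl; case: ifP => _ /=; lia.
split=> [[z Hz]|].
  have [||k ->] := odd_sum (fold (A2odd hl) z).
  - move=> i i_gt0 lt_il; rewrite /chain_eq -Hz; last by lia.
    by apply: chain_eq_A2odd.
  - by rewrite -Hz // row_A2odd_last /= eqxx !ifN //; lia.
  rewrite -Hz ?row_A2odd_1 /= ?eqxx; last by lia.
  by rewrite !ifN; lia.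
case: l => [//|l] in hl p lev odd_sum *.
(* The last node is now [l.+1]; its value 0 is even, hence can be unfolded, and [- p l.+1] solves
   its row. The sum then has the parity of [f 2 + p 1], which row 1 halves. *)
have [f [fl fl1 Hf]] := chain_down l (- p l.+1) 0 p.
have [i _|/=|k ->] := odd_sum f; [exact: Hf | by rewrite fl fl1; lia |].
rewrite fl1 => Hp.
have [z1 Hz1] : exists k, 2 * k = f 2%N + p 1%N.
  by exists ((f 2%N + p 1%N) %/ 2)%Z; lia.
pose z i := if i == 0%N then f 1%N - z1 else if i == 1%N then z1 else f i.
have zE i : (1 < i)%N -> z i = f i by case: i => [|[]].
have foldz i : (0 < i)%N -> fold (A2odd hl) z i = f i.
  move=> i_gt0 /=; case: eqP => [->|ne_i1]; first by rewrite /z /=; lia.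
  by case: eqP => [->|_]; rewrite zE ?fl1 //; lia.
exists z; apply: (null_level_row lev (r := 0%N)) => // -[|[|i]] //= lt_il _.
  by rewrite row_A2odd_1 (zE 2%N) // /z /=; lia.
have [->|ne_il] := eqVneq i.+1 l.
  by rewrite row_A2odd_last /= !zE ?fl ?fl1; lia.
by rewrite (chain_eq_A2odd hl) ?foldz ?(Hf i.+1) //; lia.
Qed.

(** Starting from 0 at the last node makes [f] its own folding, and every row but the dropped row 0
    is solved without a division. *)
Lemma A2evenP l (hl : (1 <= l)%N) p : null_level (A2even hl) p ->
  exists z, forall i, (i <= l)%N -> cartan_row (A2even hl) z i = p i.
Proof.
case: l => [//|l] in hl p *; move=> lev.
have [f [fl fl1 Hf]] := chain_down l (- p l.+1) 0 p.
have foldf i : fold (A2even hl) f i = f i.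
  by rewrite /=; case: eqP => // ->; rewrite fl1.
exists f; apply: (null_level_row lev (r := 0%N)) => // -[|i] //= lt_il _.
have [->|ne_il] := eqVneq i l.
  by rewrite row_A2even_last /= fl fl1; lia.
by rewrite (chain_eq_A2even hl) ?foldf ?(Hf i) //; lia.
Qed.

(** * Passage from hubs to the integer systems, type by type *)

Theorem proposition3p6 (R : realType) (X : affine_type)
  (H : affine_realization (complex R) (cartan X))
  (a : 'I_(rank X).+1 -> nat) (ha : is_dual_labels (cartan X) a)
  (theta kappa : 'rV[int]_((rank X).+1))
  (htheta : is_integral_hub H theta) (hkappa : is_integral_hub H kappa)
  (hlevel : level a theta = level a kappa) :
  in_simple_root_hub_span H (theta - kappa) <-> congruences (theta - kappa).
Proof.
have lev : level a (theta - kappa) = 0.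
  rewrite -(subrr (level a kappa)) -{1}hlevel /level -sumrB.
  by apply: eq_bigr => i _; rewrite !mxE mulrBr.
rewrite spanP; have := null_levelP ha lev.
move: (theta - kappa) => psi {lev htheta hkappa hlevel theta kappa ha a H}.
case: X psi => [l hl|l hl|l hl|l hl|l hl|l hl|l hl| | | | | | |] psi lev.
- exact: A1P.
- exact: B1P.
- exact: C1P.
- exact: D1P.
- exact: D2P.
- exact: A2oddP.
- by split=> // _; exact: A2evenP.
- exact: E16P.
- exact: E17P.
- by split=> // _; exact: E18P.
- by split=> // _; exact: F14P.
- by split=> // _; exact: E26P.
- by split=> // _; exact: G12P.
- by split=> // _; exact: D34P.
Qed.
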